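(* Let $X$ and $Y$ be metric spaces equipped with nets $(X_0,i_X,e_X)$ and $(Y_0,i_Y,e_Y)$, and let $X\ast Y$ be their free product, equipped with its metric $d_\ast$. If $X$ and $Y$ are geodesic Gromov hyperbolic spaces, then $X\ast Y$ is also a geodesic Gromov hyperbolic space.
   Context: **Nets.** A net of a metric space $(X,d_X)$ is a triple $(X_0,i_X,e_X)$ where $X_0$ is a set, $i_X:X_0\to X$ is a map such that $i_X^{-1}(K)$ is finite for every compact $K\subseteq X$, and $e_X\in i_X(X_0)$ (the base point). Write $\overline{x_0}=i_X(x_0)$ for $x_0\in X_0$. **Words.** Given nets of $X$ and $Y$, choose $\epsilon_X\in X_0$, $\epsilon_Y\in Y_0$ with $i_X(\epsilon_X)=e_X$, $i_Y(\epsilon_Y)=e_Y$; put $X_0^*=X_0\setminus\{\epsilon_X\}$, $Y_0^*=Y_0\setminus\{\epsilon_Y\}$. A normal word is a finite sequence $w_0w_1\cdots w_n$ ($n\ge 0$) of elements of $X_0^*\sqcup Y_0^*$ whose letters alternate between $X_0^*$ and $Y_0^*$. Let $\epsilon$ be the empty word. $W$ is the set of all normal words together with $\epsilon$; $W_X$ (resp. $W_Y$) consists of $\epsilon$ and all normal words whose last letter is not in $X_0^*$ (resp. not in $Y_0^*$). **Free product.** Let $$\widetilde{X\ast Y}=(W_X\times X)\sqcup(W_Y\times Y)\sqcup(W_X\times X_0^*\times[0,1])\sqcup(W_Y\times Y_0^*\times[0,1])\sqcup(\{\epsilon\}\times[0,1]).$$ Let $\sim$ be the equivalence relation generated by: (i)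 the point $(\epsilon,e_X)\in W_X\times X$ is identified with $(\epsilon,0)\in\{\epsilon\}\times[0,1]$, and $(\epsilon,e_Y)\in W_Y\times Y$ with $(\epsilon,1)\in\{\epsilon\}\times[0,1]$; (ii) for $\omega\in W_X$, $x_0\in X_0^*$: $(\omega,\overline{x_0})\sim(\omega,x_0,0)$ and $(\omega x_0,e_Y)\sim(\omega,x_0,1)$, where $(\omega,\overline{x_0})\in W_X\times X$ and $(\omega x_0,e_Y)\in W_Y\times Y$; (iii) for $\tau\in W_Y$, $y_0\in Y_0^*$: $(\tau,\overline{y_0})\sim(\tau,y_0,0)$ and $(\tau y_0,e_X)\sim(\tau,y_0,1)$, where $(\tau,\overline{y_0})\in W_Y\times Y$ and $(\tau y_0,e_X)\in W_X\times X$. The free product is $X\ast Y=\widetilde{X\ast Y}/\sim$. The sets $\{\omega\}\times X$ ($\omega\in W_X$) and $\{\tau\}\times Y$ ($\tau\in W_Y$) are called sheets; the sets $\{\epsilon\}\times[0,1]$, $\{\omega\}\times\{x_0\}\times[0,1]$, $\{\tau\}\times\{y_0\}\times[0,1]$ are called edges. The sheets (as vertices) and edges form a tree. **Metric $d_\ast$.** Each sheet carries the metric $d_X$ or $d_Y$, and each edge carries the metric $|t_1-t_2|$ of $[0,1]$. The metric $d_\ast$ on $X\ast Y$ is the shortest-path distance: $d_\ast(p,q)$ is the infimum of $\sum_{i=1}^n d_{C_i}(p_{i-1},p_i)$ over all finite chains $p=p_0,p_1,\dots,p_n=q$ in which $p_{i-1},p_i$ lie in a common sheet or edge $C_i$ with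 metric $d_{C_i}$. (By the tree structure it is attained along the unique route between $p$ and $q$; e.g. for $p=(x_0y_0,u)$ and $q=(\epsilon,v)$ with $u,v\in X$, $d_\ast(p,q)=d_X(v,\overline{x_0})+1+d_Y(\overline{y_0},e_Y)+1+d_X(e_X,u)$.) **Geodesic hyperbolicity.** A metric space is geodesic if any two points are joined by a geodesic (an isometric image of a compact interval). In a geodesic space $Z$, a geodesic triangle with vertices $x,y,z$ is a union $[x,y]\cup[y,z]\cup[z,x]$ of three geodesics joining the vertices. $Z$ satisfies the $\delta$-Rips condition ($\delta\ge 0$) if in every geodesic triangle each side is contained in the $\delta$-neighborhood $N(\cdot;\delta)$ (points at distance at most $\delta$) of the union of the other two sides. A geodesic space is a geodesic Gromov hyperbolic space if it satisfies the $\delta$-Rips condition for some $\delta\ge0$. *)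

(* Defs.v *)
From HB Require Import structures.
From mathcomp Require Import all_boot all_order all_algebra.
From mathcomp Require Import generic_quotient.
From mathcomp Require Import all_classical all_reals interval_inference topology.
From mathcomp Require Import ring lra.
From Stdlib Require Import Relation_Operators.

Set Implicit Arguments.
Unset Strict Implicit.
Unset Printing Implicit Defensive.

Import Order.TTheory GRing.Theory Num.Theory.

Local Open Scope classical_set_scope.
Local Open Scope ring_scope.
Local Open Scope quotient_scope.

Section GeodesicHyperbolic.
Context {R : realType} (Z : metricType R).
Implicit Types (x y z : Z) (A B C : set Z).

Definition geodesic_between x y A :=
  exists a b : R, exists g : R -> Z,
    [/\ a <= b,
        {in `[a, b]%R &, forall s t, mdist (g s) (g t) = `|s - t|},
        g a = x, g b = y & A = g @` `[a, b]].

Definition geodesic_space := forall x y, exists A, geodesic_between x y A.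

(* For compact A, in particular for a union of geodesics, this is also the set
   of the z such that inf_(a in A) mdist z a <= d. *)
Definition closed_nbhd A (d : R) : set Z :=
  [set z | exists2 a, A a & mdist z a <= d].

Definition rips_condition (delta : R) :=
  forall x y z A B C,
    geodesic_between x y A -> geodesic_between y z B ->
    geodesic_between z x C ->
    [/\ A `<=` closed_nbhd (B `|` C) delta,
        B `<=` closed_nbhd (C `|` A) delta
      & C `<=` closed_nbhd (A `|` B) delta].

Definition geodesic_gromov_hyperbolic :=
  geodesic_space /\ exists2 delta : R, 0 <= delta & rips_condition delta.

End GeodesicHyperbolic.

Record net {R : realType} (X : metricType R) := Net {
  net_set :> Type;
  net_map : net_set -> X;
  net_base : X;
  net_finite : forall K : set X, compact K -> finite_set (net_map @^-1` K);
  net_baseP : range net_map net_base }.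

Arguments net_map {R X} n x0.
Arguments net_base {R X} n.

Section Words.
Variables (X0 Y0 : Type) (epsX : X0) (epsY : Y0).

Definition lettersX := {x0 : X0 | x0 <> epsX}.
Definition lettersY := {y0 : Y0 | y0 <> epsY}.
Definition letter := (lettersX + lettersY)%type.

Definition is_X (l : letter) := if l is inl _ then true else false.
Definition is_Y (l : letter) := ~~ is_X l.

(* Including the empty word. *)
Definition normal_word (w : seq letter) :=
  sorted (fun l l' => is_X l != is_X l') w.

Definition wordsX :=
  {w : seq letter | normal_word w && ~~ last false (map is_X w)}.
Definition wordsY :=
  {w : seq letter | normal_word w && ~~ last false (map is_Y w)}.

Definition emptyX : wordsX := exist _ [::] isT.
Definition emptyY : wordsY := exist _ [::] isT.

Lemma normal_word_rcons w l :
  normal_word (rcons w l) =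
  normal_word w && (last (~~ is_X l) (map is_X w) != is_X l).
Proof.
rewrite /normal_word; case: w => [|a w] /=; first by case: is_X.
by rewrite rcons_path last_map.
Qed.

Lemma rconsX_subproof (w : wordsX) (x0 : lettersX) :
  normal_word (rcons (sval w) (inl x0)) &&
  ~~ last false (map is_Y (rcons (sval w) (inl x0))).
Proof.
rewrite map_rcons last_rcons andbT normal_word_rcons.
by case: w => -[|a w] //= /andP[-> h]; rewrite !last_map in h *; case: is_X h.
Qed.

Lemma rconsY_subproof (w : wordsY) (y0 : lettersY) :
  normal_word (rcons (sval w) (inr y0)) &&
  ~~ last false (map is_X (rcons (sval w) (inr y0))).
Proof.
rewrite map_rcons last_rcons andbT normal_word_rcons.
case: w => -[|a w] //= /andP[-> h].
by move: h; rewrite !last_map /is_Y; case: is_X.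
Qed.

Definition rconsX (w : wordsX) (x0 : lettersX) : wordsY :=
  exist _ (rcons (sval w) (inl x0)) (rconsX_subproof w x0).
Definition rconsY (w : wordsY) (y0 : lettersY) : wordsX :=
  exist _ (rcons (sval w) (inr y0)) (rconsY_subproof w y0).

End Words.

Arguments emptyX {X0 Y0 epsX epsY}.
Arguments emptyY {X0 Y0 epsX epsY}.

Section FreeProduct.
Context {R : realType} {X Y : metricType R} (NX : net X) (NY : net Y).
(* epsX and epsY are meant to be labels of the base points; none of the
   definitions depends on this, so that it is left to the statements about
   free products to assume it. *)
Variables (epsX : NX) (epsY : NY).

Local Notation WX := (wordsX epsX epsY).
Local Notation WY := (wordsY epsX epsY).
Local Notation eX := (net_base NX).
Local Notation eY := (net_base NY).

Inductive pre_free_product :=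
| SheetX (w : WX) (x : X)
| SheetY (w : WY) (y : Y)
| EdgeX (w : WX) (x0 : lettersX epsX) (t : {i01 R})
| EdgeY (w : WY) (y0 : lettersY epsY) (t : {i01 R})
| Edge0 (t : {i01 R}).

HB.instance Definition _ := gen_eqMixin pre_free_product.
HB.instance Definition _ := gen_choiceMixin pre_free_product.

Inductive glue : pre_free_product -> pre_free_product -> Prop :=
| glue0X : glue (SheetX emptyX eX) (Edge0 0%:i01)
| glue0Y : glue (SheetY emptyY eY) (Edge0 1%:i01)
| glueX0 w x0 : glue (SheetX w (net_map NX (sval x0))) (EdgeX w x0 0%:i01)
| glueX1 w x0 : glue (SheetY (rconsX w x0) eY) (EdgeX w x0 1%:i01)
| glueY0 w y0 : glue (SheetY w (net_map NY (sval y0))) (EdgeY w y0 0%:i01)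
| glueY1 w y0 : glue (SheetX (rconsY w y0) eX) (EdgeY w y0 1%:i01).

Definition glued : rel pre_free_product :=
  fun p q => `[< clos_refl_sym_trans _ glue p q >].

Lemma glued_refl : reflexive glued.
Proof. by move=> p; apply/asboolP; exact: rst_refl. Qed.

Lemma glued_sym : symmetric glued.
Proof. by move=> p q; apply/asboolP/asboolP; exact: rst_sym. Qed.

Lemma glued_trans : transitive glued.
Proof.
by move=> q p r /asboolP pq /asboolP qr; apply/asboolP; exact: rst_trans pq qr.
Qed.

Definition glued_equiv := EquivRel glued glued_refl glued_sym glued_trans.

Definition free_product := {eq_quot glued_equiv}.

HB.instance Definition _ := Choice.on free_product.
HB.instance Definition _ := Quotient.on free_product.

Local Notation FP := free_product.
Local Notation pi := (\pi_FP).

(* [piece_dist p q l]: p and q lie in a common sheet or edge, and l is their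
   distance there. *)
Inductive piece_dist : FP -> FP -> R -> Prop :=
| dist_sheetX w x x' : piece_dist (pi (SheetX w x)) (pi (SheetX w x')) (mdist x x')
| dist_sheetY w y y' : piece_dist (pi (SheetY w y)) (pi (SheetY w y')) (mdist y y')
| dist_edgeX w x0 s t :
    piece_dist (pi (EdgeX w x0 s)) (pi (EdgeX w x0 t)) `|s%:num - t%:num|
| dist_edgeY w y0 s t :
    piece_dist (pi (EdgeY w y0 s)) (pi (EdgeY w y0 t)) `|s%:num - t%:num|
| dist_edge0 s t : piece_dist (pi (Edge0 s)) (pi (Edge0 t)) `|s%:num - t%:num|.

Inductive chain : FP -> FP -> R -> Prop :=
| chain_nil p : chain p p 0
| chain_cons p q r l m : piece_dist p q l -> chain q r m -> chain p r (l + m).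

Definition free_product_dist (p q : FP) : R := inf [set l | chain p q l].

Local Notation dstar := free_product_dist.

Lemma chain1 p q l : piece_dist p q l -> chain p q l.
Proof. by move=> pq; rewrite -[l]addr0; apply: chain_cons pq (chain_nil _). Qed.

Lemma piece_dist_sym p q l : piece_dist p q l -> piece_dist q p l.
Proof.
by case=> [w x x'|w y y'|w x0 s t|w y0 s t|s t];
  rewrite 1?metric_sym 1?distrC; constructor.
Qed.

Lemma piece_dist_ge0 p q l : piece_dist p q l -> 0 <= l.
Proof. by case=> *; rewrite ?mdist_ge0. Qed.

Lemma chain_ge0 p q l : chain p q l -> 0 <= l.
Proof. by elim=> // {}p {}q r {}l m /piece_dist_ge0 l0 _; exact: addr_ge0. Qed.

Lemma chain_cat p q r l m : chain p q l -> chain q r m -> chain p r (l + m).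
Proof.
move=> pq; elim: pq r m => [{}p r m|{}p {}q s {}l k pq _ IH r m sr]; first by rewrite add0r.
by rewrite -addrA; apply: chain_cons pq _; exact: IH.
Qed.

Lemma chain_sym p q l : chain p q l -> chain q p l.
Proof.
elim=> [{}p|{}p {}q r {}l m /piece_dist_sym pq _ IH]; first exact: chain_nil.
by rewrite addrC; apply: chain_cat IH (chain1 pq).
Qed.

Lemma pi_glue p q : glue p q -> pi p = pi q.
Proof. by move=> pq; apply/eqmodP/asboolP; exact: rst_step. Qed.

Definition joined p q := exists l, chain p q l.

Lemma joined_sym p q : joined p q -> joined q p.
Proof. by case=> l pq; exists l; exact: chain_sym. Qed.

Lemma joined_trans q p r : joined p q -> joined q r -> joined p r.
Proof. by move=> [l pq] [m qr]; exists (l + m); exact: chain_cat qr. Qed.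

Lemma joined_piece p q l : piece_dist p q l -> joined p q.
Proof. by move=> pq; exists l; exact: chain1. Qed.

Lemma joined_sheets n :
  (forall (w : WX) x, (size (sval w) <= n)%N ->
    joined (pi (SheetX w x)) (pi (SheetX emptyX eX))) /\
  (forall (w : WY) y, (size (sval w) <= n)%N ->
    joined (pi (SheetY w y)) (pi (SheetX emptyX eX))).
Proof.
have e0 y : joined (pi (SheetY emptyY y)) (pi (SheetX emptyX eX)).
  apply: joined_trans (joined_piece (dist_sheetY _ _ eY)) _.
  by rewrite (pi_glue glue0X) (pi_glue glue0Y); exact: joined_piece (dist_edge0 _ _).
elim: n => [|n [IHX IHY]].
  split=> [w x|w y]; rewrite leqn0 => /nilP w0.
    have -> : w = emptyX by case: w w0 => /= w h w0; exact: eq_exist.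
    exact: joined_piece (dist_sheetX _ _ _).
  have -> : w = emptyY by case: w w0 => /= w h w0; exact: eq_exist.
  exact: e0.
split=> [w x|w y] wn; have [|wn'] := leqP (size (sval w)) n; do ?[exact: IHX|exact: IHY].
  apply: joined_trans (joined_piece (dist_sheetX _ _ eX)) _.
  case: w wn {wn'} => /= w; case/lastP: w => [|w [x0|y0]] h.
  - by move=> _; rewrite (_ : exist _ _ _ = emptyX); [exact: joined_piece (dist_sheetX _ _ _)|exact: eq_exist].
  - by exfalso; move: h; rewrite map_rcons last_rcons andbF.
  have hw : normal_word w && ~~ last false (map (@is_Y _ _ epsX epsY) w).
    move: h; rewrite normal_word_rcons map_rcons last_rcons andbT.
    case: w => //= a w => /andP[->] /=.
    by rewrite !last_map /is_Y; case: is_X.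
  rewrite size_rcons ltnS => wn.
  rewrite (_ : exist _ _ _ = rconsY (exist _ w hw : WY) y0); last exact: eq_exist.
  rewrite (pi_glue (glueY1 _ _)).
  apply: joined_trans (joined_piece (dist_edgeY _ _ _ 0%:i01)) _.
  by rewrite -(pi_glue (glueY0 _ _)); exact: IHY.
apply: joined_trans (joined_piece (dist_sheetY _ _ eY)) _.
case: w wn {wn'} => /= w; case/lastP: w => [|w [x0|y0]] h.
- by move=> _; rewrite (_ : exist _ _ _ = emptyY); [exact: e0|exact: eq_exist].
- have hw : normal_word w && ~~ last false (map (@is_X _ _ epsX epsY) w).
    move: h; rewrite normal_word_rcons map_rcons last_rcons andbT.
    case: w => //= a w => /andP[->] /=.
    by rewrite !last_map; case: is_X.
  rewrite size_rcons ltnS => wn.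
  rewrite (_ : exist _ _ _ = rconsX (exist _ w hw : WX) x0); last exact: eq_exist.
  rewrite (pi_glue (glueX1 _ _)).
  apply: joined_trans (joined_piece (dist_edgeX _ _ _ 0%:i01)) _.
  by rewrite -(pi_glue (glueX0 _ _)); exact: IHX.
by exfalso; move: h; rewrite map_rcons last_rcons andbF.
Qed.

Lemma joined_base p : joined p (pi (SheetX emptyX eX)).
Proof.
rewrite -[p]reprK; case: (repr p) => [w x|w y|w x0 t|w y0 t|t].
- exact: (joined_sheets (size (sval w))).1.
- exact: (joined_sheets (size (sval w))).2.
- apply: joined_trans (joined_piece (dist_edgeX _ _ _ 0%:i01)) _.
  rewrite -(pi_glue (glueX0 _ _)).
  exact: (joined_sheets (size (sval w))).1.
- apply: joined_trans (joined_piece (dist_edgeY _ _ _ 0%:i01)) _.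
  rewrite -(pi_glue (glueY0 _ _)).
  exact: (joined_sheets (size (sval w))).2.
- rewrite (pi_glue glue0X); exact: joined_piece (dist_edge0 _ _).
Qed.

Lemma joinedT p q : joined p q.
Proof. exact: joined_trans (joined_base p) (joined_sym (joined_base q)). Qed.

Lemma free_product_dist_le p q l : chain p q l -> dstar p q <= l.
Proof. by move=> pq; apply: ge_inf => //; exists 0 => m /chain_ge0. Qed.

Lemma free_product_dist_ge p q c :
  (forall l, chain p q l -> c <= l) -> c <= dstar p q.
Proof. by move=> h; apply: lb_le_inf => //; exact: joinedT. Qed.

Lemma free_product_distxx p : dstar p p = 0.
Proof.
apply/eqP; rewrite eq_le free_product_dist_le; last exact: chain_nil.
by apply: free_product_dist_ge => l /chain_ge0.
Qed.

Lemma free_product_dist_sym p q : dstar p q = dstar q p.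
Proof.
by congr inf; apply/seteqP; split=> l /=; exact: chain_sym.
Qed.

Lemma free_product_dist_triangle q p r : dstar p r <= dstar p q + dstar q r.
Proof.
rewrite -lerBlDr; apply: free_product_dist_ge => l pq.
rewrite lerBlDr -lerBlDl; apply: free_product_dist_ge => m qr.
by rewrite lerBlDl; apply: free_product_dist_le; exact: chain_cat qr.
Qed.

Definition piecewise_short (f : pre_free_product -> R) :=
  [/\ forall p q, glue p q -> f p = f q,
      (forall w x x', `|f (SheetX w x) - f (SheetX w x')| <= mdist x x') /\
      (forall w y y', `|f (SheetY w y) - f (SheetY w y')| <= mdist y y'),
      forall w x0 s t,
        `|f (EdgeX w x0 s) - f (EdgeX w x0 t)| <= `|s%:num - t%:num|,
      forall w y0 s t,
        `|f (EdgeY w y0 s) - f (EdgeY w y0 t)| <= `|s%:num - t%:num|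
    & forall s t, `|f (Edge0 s) - f (Edge0 t)| <= `|s%:num - t%:num| ].

Lemma piecewise_short_pi f p q : piecewise_short f -> pi p = pi q -> f p = f q.
Proof.
case=> fg _ _ _ _ /eqmodP/asboolP.
by elim=> [{}p {}q /fg|//|//|{}p {}q r _ -> _ ->].
Qed.

Lemma piecewise_short_chain f p q l : piecewise_short f -> chain p q l ->
  `|f (repr p) - f (repr q)| <= l.
Proof.
move=> fs; have fr a : f (repr (pi a)) = f a.
  by apply: piecewise_short_pi => //; rewrite reprK.
elim=> [{}p|{}p {}q r {}l m pq _ IH]; first by rewrite subrr normr0.
rewrite -(subrKA (f (repr q))); apply: le_trans (ler_normD _ _) _.
apply: lerD IH; case: fs => _ [fX fY] feX feY fe0.
by case: pq => *; rewrite !fr.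
Qed.

Lemma free_product_dist0 f p q : piecewise_short f ->
  dstar (pi p) (pi q) = 0 -> f p = f q.
Proof.
move=> fs d0; apply/eqP; rewrite -subr_eq0 -normr_le0 -d0.
apply: free_product_dist_ge => l /(piecewise_short_chain fs).
by rewrite !(piecewise_short_pi fs (reprK _)).
Qed.

Local Definition bump (u : R) := Num.max 0 (1 - u).

Local Lemma bump_le u v : `|bump u - bump v| <= `|u - v|.
Proof.
rewrite /bump; case: (leP 0 (1 - u)) => ?; case: (leP 0 (1 - v)) => ?;
  rewrite ler_norml; case: (ler0P (u - v)) => ?; apply/andP; split; lra.
Qed.

Local Lemma bump_ge1 u : 1 <= u -> bump u = 0.
Proof. by move=> u1; apply/max_idPl; rewrite subr_le0. Qed.

Local Lemma bump_eq1 u : 0 <= u -> bump u = 1 -> u = 0.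
Proof. by rewrite /bump; case: (leP 0 (1 - u)) => *; lra. Qed.

Local Lemma bump0 : bump 0 = 1.
Proof. by rewrite /bump subr0; apply/max_idPr. Qed.

Local Lemma mdist_lip (Z : metricType R) (x y z : Z) :
  `|mdist x y - mdist x z| <= mdist y z.
Proof.
have := metric_triangle x y z; have := metric_triangle x z y.
by rewrite (metric_sym z y) ler_norml => *; apply/andP; split; lra.
Qed.

Local Lemma shiftD (d s t : R) : `|d + s - (d + t)| = `|s - t|.
Proof. by congr `| _ |; ring. Qed.

Local Lemma shiftB (d s t : R) : `|d + (1 - s) - (d + (1 - t))| = `|s - t|.
Proof. by rewrite distrC; congr `| _ |; ring. Qed.

Local Lemma num01 (t : {i01 R}) : 0 <= t%:num <= 1.
Proof. by apply/andP; split. Qed.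

(* Test functions separating points at positive distance; bumpX w x is
   max (0, 1 - d(p, (w, x))). *)
Local Definition bumpX (w : WX) (x : X) (p : pre_free_product) : R :=
  match p with
  | SheetX w' x' => if `[< w' = w >] then bump (mdist x x') else 0
  | SheetY _ _ => 0
  | EdgeX w' x0 t => if `[< w' = w >]
      then bump (mdist x (net_map NX (sval x0)) + t%:num) else 0
  | EdgeY w' y0 t => if `[< rconsY w' y0 = w >]
      then bump (mdist x eX + (1 - t%:num)) else 0
  | Edge0 t => if `[< emptyX = w >] then bump (mdist x eX + t%:num) else 0
  end.

Local Definition bumpY (w : WY) (y : Y) (p : pre_free_product) : R :=
  match p with
  | SheetX _ _ => 0
  | SheetY w' y' => if `[< w' = w >] then bump (mdist y y') else 0
  | EdgeX w' x0 t => if `[< rconsX w' x0 = w >]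
      then bump (mdist y eY + (1 - t%:num)) else 0
  | EdgeY w' y0 t => if `[< w' = w >]
      then bump (mdist y (net_map NY (sval y0)) + t%:num) else 0
  | Edge0 t => if `[< emptyY = w >] then bump (mdist y eY + (1 - t%:num)) else 0
  end.

Local Definition tent (s t : R) := Num.max 0 (Num.min s (1 - s) - `|t - s|).

Local Lemma tent0 s : 0 <= s <= 1 -> tent s 0 = 0.
Proof.
move=> /andP[s0 s1]; apply/max_idPl; rewrite sub0r normrN ger0_norm//.
by rewrite subr_le0 ge_min lexx.
Qed.

Local Lemma tent1 s : 0 <= s <= 1 -> tent s 1 = 0.
Proof.
move=> /andP[s0 s1]; apply/max_idPl; rewrite ger0_norm ?subr_ge0//.
by rewrite subr_le0 ge_min lexx orbT.
Qed.

Local Lemma tent_le s t u : `|tent s t - tent s u| <= `|t - u|.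
Proof.
have := bump_le (1 - (Num.min s (1 - s) - `|t - s|)) (1 - (Num.min s (1 - s) - `|u - s|)).
rewrite /bump !subKr -!/(tent _ _) => h; apply: le_trans h _.
set m := Num.min _ _.
rewrite (_ : _ - _ = `|t - s| - `|u - s|); last by ring.
by apply: le_trans (ler_dist_dist _ _) _; rewrite (_ : t - s - (u - s) = t - u); last ring.
Qed.

Local Lemma tent_eq s t : 0 < s < 1 -> tent s s = tent s t -> s = t.
Proof.
move=> /andP[s0 s1]; rewrite /tent subrr normr0 subr0.
have m0 : 0 < Num.min s (1 - s) by rewrite lt_min s0 subr_gt0.
set m := Num.min s (1 - s) in m0 *.
rewrite (max_idPr (ltW m0)); case: (leP 0 (m - `|t - s|)) => [_ mE|_ mE]; last by move: m0; rewrite mE ltxx.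
have /eqP : `|t - s| = 0 by lra.
by rewrite normr_eq0 subr_eq0 => /eqP.
Qed.

(* [c p] is the coordinate of p on a fixed edge, if it lies there. *)
Local Definition on_edge (c : pre_free_product -> option {i01 R}) (s : R) p :=
  if c p is Some t then tent s t%:num else 0.

Local Definition coordX (w : WX) (x0 : lettersX epsX) (p : pre_free_product) : option {i01 R} :=
  if p is EdgeX w' x0' t then
    if `[< (w', x0') = (w, x0) >] then Some t else None
  else None.

Local Definition coordY (w : WY) (y0 : lettersY epsY) (p : pre_free_product) : option {i01 R} :=
  if p is EdgeY w' y0' t then
    if `[< (w', y0') = (w, y0) >] then Some t else None
  else None.

Local Definition coord0 (p : pre_free_product) : option {i01 R} := if p is Edge0 t then Some t else None.

Local Lemma bumpX_short w x : piecewise_short (bumpX w x).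
Proof.
split=> [p q []|||| ] /=.
- by rewrite addr0.
- by case: ifP => // _; rewrite bump_ge1// lerDr mdist_ge0.
- by move=> w' x0; rewrite addr0.
- by move=> w' x0; case: ifP => // _; rewrite bump_ge1// lerDr mdist_ge0.
- by move=> w' y0; case: ifP => // _; rewrite subr0 bump_ge1// lerDr mdist_ge0.
- by move=> w' y0; rewrite subrr addr0.
- split=> [w' x1 x2|w' y1 y2]; last by rewrite subrr normr0 mdist_ge0.
  case: ifP => _; last by rewrite subrr normr0 mdist_ge0.
  exact: le_trans (bump_le _ _) (mdist_lip _ _ _).
- move=> w' x0 s t; case: ifP => _; last by rewrite subrr normr0.
  by apply: le_trans (bump_le _ _) _; rewrite shiftD.
- move=> w' y0 s t; case: ifP => _; last by rewrite subrr normr0.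
  by apply: le_trans (bump_le _ _) _; rewrite shiftB.
- move=> s t; case: ifP => _; last by rewrite subrr normr0.
  by apply: le_trans (bump_le _ _) _; rewrite shiftD.
Qed.

Local Lemma bumpY_short w y : piecewise_short (bumpY w y).
Proof.
split=> [p q []|||| ] /=.
- by case: ifP => // _; rewrite subr0 bump_ge1// lerDr mdist_ge0.
- by rewrite subrr addr0.
- by move=> w' x0; case: ifP => // _; rewrite subr0 bump_ge1// lerDr mdist_ge0.
- by move=> w' x0; rewrite subrr addr0.
- by move=> w' y0; rewrite addr0.
- by move=> w' y0; case: ifP => // _; rewrite bump_ge1// lerDr mdist_ge0.
- split=> [w' x1 x2|w' y1 y2]; first by rewrite subrr normr0 mdist_ge0.
  case: ifP => _; last by rewrite subrr normr0 mdist_ge0.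
  exact: le_trans (bump_le _ _) (mdist_lip _ _ _).
- move=> w' x0 s t; case: ifP => _; last by rewrite subrr normr0.
  by apply: le_trans (bump_le _ _) _; rewrite shiftB.
- move=> w' y0 s t; case: ifP => _; last by rewrite subrr normr0.
  by apply: le_trans (bump_le _ _) _; rewrite shiftD.
- move=> s t; case: ifP => _; last by rewrite subrr normr0.
  by apply: le_trans (bump_le _ _) _; rewrite shiftB.
Qed.

Local Lemma edge_short c s : 0 <= s <= 1 ->
  [\/ exists w x0, c = coordX w x0, exists w y0, c = coordY w y0 | c = coord0] ->
  piecewise_short (on_edge c s).
Proof.
move=> s01 h; rewrite /on_edge; have [t0 t1] := (tent0 s01, tent1 s01).
case: h => [[w [x0 ->]]|[w [y0 ->]]|->]; split=> [p q []|||| ] /=;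
  do ?[by split=> *; rewrite subrr normr0 mdist_ge0];
  do ?[by move=> *; case: ifP => // _; rewrite ?t0 ?t1 ?subrr ?normr0// tent_le];
  by move=> *; rewrite ?t0 ?t1 ?subrr ?normr0// tent_le.
Qed.

Local Lemma add_eq0 (u v : R) : 0 <= u -> 0 <= v -> u + v = 0 -> u = 0 /\ v = 0.
Proof. by move=> u0 v0 uv; split; lra. Qed.

Local Lemma i01_eq0 (t : {i01 R}) : t%:num = 0 -> t = 0%:i01.
Proof. by move=> t0; apply/val_inj. Qed.

Local Lemma i01_eq1 (t : {i01 R}) : 1 - t%:num = 0 -> t = 1%:i01.
Proof. by move=> t1; apply/val_inj => /=; lra. Qed.

Local Lemma bump_sheet (d t : R) : 0 <= d -> 0 <= t -> 1 = bump (d + t) ->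
  d = 0 /\ t = 0.
Proof. by move=> d0 t0 /esym/bump_eq1 h; apply: add_eq0 => //; apply: h; apply: addr_ge0. Qed.

Lemma free_product_dist_sheetX w x q :
  dstar (pi (SheetX w x)) (pi q) = 0 -> pi (SheetX w x) = pi q.
Proof.
move=> /(free_product_dist0 (bumpX_short w x)) /=.
rewrite asboolT// mdistxx bump0.
case: q => [w' x'|w' y'|w' x0 t|w' y0 t|t] /=; do ?[case: asboolP => [<-|_]];
  do ?[by move/eqP; rewrite oner_eq0]; try case/andP: (num01 t) => t0 t1.
- by move/esym/bump_eq1 => /(_ (mdist_ge0 _ _))/mdist_positivity ->.
- by move=> /(bump_sheet (mdist_ge0 _ _) t0)[/mdist_positivity -> /i01_eq0 ->]; exact: pi_glue (glueX0 _ _).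
- rewrite -subr_ge0 in t1.
  by move=> /(bump_sheet (mdist_ge0 _ _) t1)[/mdist_positivity -> /i01_eq1 ->]; exact: pi_glue (glueY1 _ _).
- by move=> /(bump_sheet (mdist_ge0 _ _) t0)[/mdist_positivity -> /i01_eq0 ->]; exact: pi_glue glue0X.
Qed.

Lemma free_product_dist_sheetY w y q :
  dstar (pi (SheetY w y)) (pi q) = 0 -> pi (SheetY w y) = pi q.
Proof.
move=> /(free_product_dist0 (bumpY_short w y)) /=.
rewrite asboolT// mdistxx bump0.
case: q => [w' x'|w' y'|w' x0 t|w' y0 t|t] /=; do ?[case: asboolP => [<-|_]];
  do ?[by move/eqP; rewrite oner_eq0]; try case/andP: (num01 t) => t0 t1;
  try (rewrite -subr_ge0 in t1).
- by move/esym/bump_eq1 => /(_ (mdist_ge0 _ _))/mdist_positivity ->.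
- by move=> /(bump_sheet (mdist_ge0 _ _) t1)[/mdist_positivity -> /i01_eq1 ->]; exact: pi_glue (glueX1 _ _).
- by move=> /(bump_sheet (mdist_ge0 _ _) t0)[/mdist_positivity -> /i01_eq0 ->]; exact: pi_glue (glueY0 _ _).
- by move=> /(bump_sheet (mdist_ge0 _ _) t1)[/mdist_positivity -> /i01_eq1 ->]; exact: pi_glue glue0Y.
Qed.

Local Lemma i01_trichotomy (t : {i01 R}) :
  [\/ t = 0%:i01, t = 1%:i01 | 0 < t%:num < 1].
Proof.
case/andP: (num01 t); rewrite le_eqVlt => /orP[/eqP/esym/i01_eq0 ->|t0]; first by constructor 1.
rewrite le_eqVlt => /orP[/eqP t1|t1]; last by constructor 3; rewrite t0.
by constructor 2; apply: i01_eq1; rewrite t1 subrr.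
Qed.

Local Lemma tent_gt0 s : 0 < s < 1 -> tent s s != 0.
Proof.
move=> s01; apply/eqP => h; case/andP: (s01) => s0 s1.
have : tent s s = tent s 0 by rewrite h tent0// !ltW.
by move/(tent_eq s01) => s00; rewrite s00 ltxx in s0.
Qed.

Lemma free_product_positivity p q : dstar p q = 0 -> p = q.
Proof.
rewrite -[p]reprK -[q]reprK; move: (repr p) (repr q) => {p q} p q.
case: p => [w x|w y|w x0 s|w y0 s|s].
- exact: free_product_dist_sheetX.
- exact: free_product_dist_sheetY.
- case: (i01_trichotomy s) => [->|->|s01].
  + by rewrite -(pi_glue (glueX0 _ _)); exact: free_product_dist_sheetX.
  + by rewrite -(pi_glue (glueX1 _ _)); exact: free_product_dist_sheetY.
  move=> /(free_product_dist0 (edge_short (num01 s) (Or31 _ _ (ex_intro _ w (ex_intro _ x0 erefl))))).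
  rewrite /on_edge /= asboolT//.
  case: q => [w' x'|w' y'|w' x1 t|w' y1 t|t] /=; do ?[by move/eqP/negPn; rewrite tent_gt0].
  case: asboolP => [[-> ->]|_]; last by move/eqP/negPn; rewrite tent_gt0.
  by move=> /(tent_eq s01)/val_inj ->.
- case: (i01_trichotomy s) => [->|->|s01].
  + by rewrite -(pi_glue (glueY0 _ _)); exact: free_product_dist_sheetY.
  + by rewrite -(pi_glue (glueY1 _ _)); exact: free_product_dist_sheetX.
  move=> /(free_product_dist0 (edge_short (num01 s) (Or32 _ _ (ex_intro _ w (ex_intro _ y0 erefl))))).
  rewrite /on_edge /= asboolT//.
  case: q => [w' x'|w' y'|w' x1 t|w' y1 t|t] /=; do ?[by move/eqP/negPn; rewrite tent_gt0].
  case: asboolP => [[-> ->]|_]; last by move/eqP/negPn; rewrite tent_gt0.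
  by move=> /(tent_eq s01)/val_inj ->.
- case: (i01_trichotomy s) => [->|->|s01].
  + by rewrite -(pi_glue glue0X); exact: free_product_dist_sheetX.
  + by rewrite -(pi_glue glue0Y); exact: free_product_dist_sheetY.
  move=> /(free_product_dist0 (edge_short (num01 s) (Or33 _ _ erefl))).
  rewrite /on_edge /=.
  case: q => [w' x'|w' y'|w' x1 t|w' y1 t|t] /=; do ?[by move/eqP/negPn; rewrite tent_gt0].
  by move=> /(tent_eq s01)/val_inj ->.
Qed.

HB.instance Definition _ := isMetric.Build R free_product
  free_product_distxx free_product_positivity free_product_dist_sym
  free_product_dist_triangle.

Lemma mdist_free_productE (p q : free_product) :
  mdist p q = inf [set l | chain p q l].
Proof. by []. Qed.

End FreeProduct.

(* Main.v *)
Require Import Defs.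
From HB Require Import structures.
From mathcomp Require Import all_boot all_order all_algebra.
From mathcomp Require Import generic_quotient.
From mathcomp Require Import all_classical all_reals interval_inference topology.
From mathcomp Require Import ring lra.

(** The sheets and edges of a free product are glued along a tree.  The tree is
felt by the metric only through the following property of the nearest point
retraction [r_C] of the free product onto a piece (sheet or edge) [C]: on any
other piece [r_C] is constant.  A piece other than [C] lies behind a single
point of [C], and [r_C] sends it to this point.

Suppose then that a metric space is covered by subsets with such retractions
and that its metric is the infimum of the lengths of chains of steps inside
pieces ([tree_of_pieces]).  Following a chain, its image under [r_C] moves only
while the chain runs inside [C], where [r_C] is the identity.  Hence, whenever
[r_C p] and [r_C q] differ,
  d(p, q) = d(p, r_C p) + d(r_C p, r_C q) + d(r_C q, q)    ([retract_mdist]),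
so that every geodesic from [p] to [q] passes through [r_C p] and [r_C q], and
between them is a geodesic of [C] ([geodesic_between_retract]).  Two
consequences follow.

Geodesics exist: a chain is turned into a geodesic one step at a time, by
replacing the start of the geodesic built so far with a geodesic of the piece
in which the new step is made ([tree_geodesic_space]).

Triangles are slim ([tree_rips]): let [u] be a point on the side from [x] to
[y].  If [u] is not [x], some piece [C] contains [u] and retracts [x] to a point
other than [u] ([retract_separates]): on leaving [u] for [x] one has to move
inside some piece.  Then [u] lies on the part of the side between [r_C x] and
[r_C y], and the triangle with vertices [r_C x], [r_C y], [r_C z] is a triangle
of [C] whose nondegenerate sides are parts of the sides of the given triangle.
So slimness in [C] gives slimness at [u], with the same constant.

For the free product, retractions are read off from words ([coordX],
[coordY], [coordE], [coord0]).  Since they are constant on the other pieces, they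
do not increase lengths, and so each piece is isometric to [X], [Y] or [0, 1].
Intervals are 0-slim, and the larger of the constants of [X] and [Y] works for
the free product. *)

Set Implicit Arguments.
Unset Strict Implicit.
Unset Printing Implicit Defensive.

Import Order.TTheory GRing.Theory Num.Theory.

Local Open Scope classical_set_scope.
Local Open Scope ring_scope.
Local Open Scope quotient_scope.

(** * Geodesics *)

Section Geodesics.
Context {R : realType} {Z : metricType R}.
Implicit Types (x y z : Z) (A B C : set Z).

Lemma geodesic_between_xx x : geodesic_between x x [set x].
Proof.
exists 0, 0, (fun=> x); split=> //.
  move=> s t; rewrite !in_itv/= -!eq_le => /eqP <- /eqP <-.
  by rewrite mdistxx subrr normr0.
by apply/seteqP; split=> [u -> /=|u [s _ <-]//]; exists 0 => //=; rewrite in_itv/= !lexx.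
Qed.

Lemma geodesic_between_sym x y A :
  geodesic_between x y A -> geodesic_between y x A.
Proof.
move=> [a [b [g [ab gd ga gb ->]]]].
exists (- b), (- a), (g \o -%R); split; rewrite /= ?opprK ?lerN2//.
  move=> s t; rewrite !in_itv/= => /andP[s1 s2] /andP[t1 t2].
  rewrite gd ?in_itv/=; [|by apply/andP; split; lra..].
  by rewrite -normrN; congr `| _ |; ring.
apply/seteqP; split=> _ [s /= sab <-]; exists (- s); rewrite /= ?opprK//;
  move: sab; rewrite !in_itv/= => /andP[? ?]; apply/andP; split; lra.
Qed.

Lemma geodesic_between_ends x y A : geodesic_between x y A -> A x /\ A y.
Proof.
move=> [a [b [g [ab gd <- <- ->]]]].
by split; [exists a|exists b] => //=; rewrite in_itv/= ab lexx.
Qed.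

Lemma geodesic_betweenD x y A u : geodesic_between x y A -> A u ->
  mdist x u + mdist u y = mdist x y.
Proof.
move=> [a [b [g [ab gd <- <- ->]]]] [s /=]; rewrite in_itv/= => /andP[sa sb] <-.
rewrite !gd ?in_itv/= ?lexx ?ab ?sa ?sb//.
by rewrite !ler0_norm; lra.
Qed.

Lemma geodesic_between_at x y A (s : R) : geodesic_between x y A ->
  0 <= s <= mdist x y ->
  exists2 u, A u & mdist x u = s /\ mdist u y = mdist x y - s.
Proof.
move=> [a [b [g [ab gd <- <- ->]]]].
rewrite gd ?in_itv/= ?lexx ?ab// ler0_norm ?subr_le0// => /andP[s0 sd].
have sab : a <= a + s <= b by apply/andP; split; lra.
exists (g (a + s)); first by exists (a + s).
by rewrite !gd ?in_itv/= ?lexx ?ab//; case/andP: sab => *; rewrite !ler0_norm; lra.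
Qed.

(** The part of a geodesic between two of its points is described by distances
to the starting point, so that membership in it can be checked without
choosing a parametrization. *)
Lemma sub_geodesic x y A u v : geodesic_between x y A -> A u -> A v ->
  mdist x u <= mdist x v ->
  geodesic_between u v
    [set w | A w /\ mdist x u <= mdist x w <= mdist x v].
Proof.
move=> [a [b [g [ab gd <- gb ->]]]] [s /= sab <-] [t /= tab <-].
have aab : a \in `[a, b] by rewrite in_itv/= ab lexx.
have ga r : r \in `[a, b] -> mdist (g a) (g r) = r - a.
  move=> rab; rewrite gd//; move: rab; rewrite in_itv/= => /andP[? ?].
  by rewrite ler0_norm; lra.
rewrite !ga// lerD2r => st.
have sub r : r \in `[s, t] -> r \in `[a, b].
  move: sab tab; rewrite !in_itv/= => /andP[? ?] /andP[? ?] /andP[? ?].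
  by apply/andP; split; lra.
exists s, t, g; split=> //; first by move=> r r' /sub ? /sub ?; exact: gd.
apply/seteqP; split=> [_ [[r /= rab <-]]|_ [r /= rst <-]].
  by rewrite ga// !lerD2r => rst; exists r => //=; rewrite in_itv.
by split; [exists r => //; exact: sub|rewrite ga ?sub// !lerD2r; rewrite in_itv in rst].
Qed.

(** Two geodesics concatenate as soon as their lengths add up to the distance of
the far ends: any shortcut between them would shorten the whole path. *)
Lemma geodesic_between_cat x y z A B :
  geodesic_between x y A -> geodesic_between y z B ->
  mdist x z = mdist x y + mdist y z -> exists C, geodesic_between x z C.
Proof.
move=> [a [b [g [ab gd gx gy _]]]] [c [d [h [cd hd hy hz _]]]].
have -> : mdist x y = b - a.
  by rewrite -gx -gy gd ?in_itv/= ?lexx ?ab// ler0_norm ?subr_le0// opprB.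
have -> : mdist y z = d - c.
  by rewrite -hy -hz hd ?in_itv/= ?lexx ?cd// ler0_norm ?subr_le0// opprB.
move=> xz.
pose k s := if s <= b then g s else h (s - b + c).
have kk s t : s \in `[a, b + (d - c)] -> t \in `[a, b + (d - c)] -> s <= t ->
    mdist (k s) (k t) = `|s - t|.
  rewrite !in_itv/= => /andP[as_ sd] /andP[at_ td] st; rewrite /k.
  case: (leP t b) => tb.
    have sb : s <= b by lra.
    by rewrite sb gd// in_itv/=; apply/andP; split; lra.
  case: (leP s b) => sb; last first.
    rewrite hd ?in_itv/=; do 2?[by apply/andP; split; lra].
    by congr `| _ |; ring.
  have gs : s \in `[a, b] by rewrite in_itv/= as_.
  have ht : t - b + c \in `[c, d] by rewrite in_itv/=; apply/andP; split; lra.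
  have aI : a \in `[a, b] by rewrite in_itv/= ab lexx.
  have bI : b \in `[a, b] by rewrite in_itv/= ab lexx.
  have cI : c \in `[c, d] by rewrite in_itv/= cd lexx.
  have dI : d \in `[c, d] by rewrite in_itv/= cd lexx.
  have gsb := gd _ _ gs bI; have gas := gd _ _ aI gs.
  have hct := hd _ _ cI ht; have htd := hd _ _ ht dI.
  rewrite gx gy hy hz in gsb gas hct htd.
  have := metric_triangle (g s) y (h (t - b + c)).
  have := metric_triangle x (g s) z.
  have := metric_triangle (g s) (h (t - b + c)) z.
  rewrite gsb gas hct htd xz !ler0_norm; lra.
exists (k @` `[a, b + (d - c)]); exists a, (b + (d - c)), k; split=> //.
- lra.
- move=> s t sI tI; have [st|/ltW ts] := leP s t; first exact: kk.
  by rewrite metric_sym distrC kk.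
- by rewrite /k ab.
- rewrite /k; case: (leP (b + (d - c)) b) => dc; last by rewrite (_ : _ + c = d) //; ring.
  have -> : b + (d - c) = b by lra.
  by rewrite gy -hy (_ : c = d)//; lra.
Qed.

End Geodesics.

(** * Geodesic and slim subsets *)

Section Pieces.
Context {R : realType} {Z : metricType R}.
Implicit Types (x y z : Z) (A B C : set Z).

Definition geodesic_subset C := forall x y, C x -> C y ->
  exists2 A, A `<=` C & geodesic_between x y A.

(** The Rips condition for the triangles with sides in [C].  Only the first side
is mentioned, as the condition on the two others follows by rotating the
triangle. *)
Definition slim_subset C (delta : R) := forall x y z A B D,
  geodesic_between x y A -> geodesic_between y z B -> geodesic_between z x D ->
  A `<=` C -> B `<=` C -> D `<=` C -> A `<=` closed_nbhd (B `|` D) delta.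

Lemma slim_subset_le C (d e : R) : d <= e -> slim_subset C d -> slim_subset C e.
Proof.
move=> de Cd x y z A B D xy yz zx AC BC DC u Au.
have [v BDv uv] := Cd x y z A B D xy yz zx AC BC DC u Au.
by exists v => //; exact: le_trans de.
Qed.

Lemma slim_subset_rips (delta : R) :
  slim_subset setT delta -> rips_condition Z delta.
Proof.
by move=> slim x y z A B D xy yz zx; split;
  [exact: (slim x y z)|exact: (slim y z x)|exact: (slim z x y)].
Qed.

Section Isometry.
Context {T : metricType R} (h : T -> Z).
Hypothesis hd : forall a b, mdist (h a) (h b) = mdist a b.

Lemma isometry_geodesic_subset : geodesic_space T -> geodesic_subset (range h).
Proof.
move=> Tg _ _ [x _ <-] [y _ <-]; have [A [a [b [g [ab gd gx gy _]]]]] := Tg x y.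
exists ((h \o g) @` `[a, b]); first by move=> _ [s _ <-]; exists (g s).
exists a, b, (h \o g); split; rewrite /= ?gx ?gy// => s t sI tI.
by rewrite hd gd.
Qed.

(** The image of [h] need not be convex, hence the hypothesis that the geodesic
stays in it. *)
Lemma geodesic_between_preimage (a b : T) A : A `<=` range h ->
  geodesic_between (h a) (h b) A ->
  exists2 A', geodesic_between a b A' & A = h @` A'.
Proof.
move=> Ah [s [t [g [st gd ga gb AE]]]].
have /choice[f fE] : forall r, exists c, r \in `[s, t] -> h c = g r.
  move=> r; have [rI|] := boolP (r \in `[s, t]); last by exists a.
  have [|c _ cE] := Ah (g r); first by rewrite AE; exists r.
  by exists c.
have sI : s \in `[s, t] by rewrite in_itv/= lexx st.
have tI : t \in `[s, t] by rewrite in_itv/= lexx st.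
exists (f @` `[s, t]).
  exists s, t, f; split=> //.
  - by move=> r r' rI r'I; rewrite -hd !fE// gd.
  - by apply: mdist_positivity; rewrite -hd fE// ga mdistxx.
  - by apply: mdist_positivity; rewrite -hd fE// gb mdistxx.
rewrite AE image_comp; apply/seteqP.
by split=> _ [r rI <-]; exists r => //=; rewrite fE.
Qed.

Lemma isometry_slim_subset (delta : R) :
  rips_condition T delta -> slim_subset (range h) delta.
Proof.
move=> Tslim x y z A B D xy yz zx AC BC DC.
have [[xC yC] [_ zC]] := (geodesic_between_ends xy, geodesic_between_ends yz).
case: (AC _ xC) (AC _ yC) (BC _ zC) => [a _ ax] [b _ bY] [c _ cz].
rewrite -ax -bY -cz in xy yz zx.
have [A' ab ->] := geodesic_between_preimage AC xy.
have [B' bc ->] := geodesic_between_preimage BC yz.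
have [D' ca ->] := geodesic_between_preimage DC zx.
move=> _ [u Au <-]; have [AN _ _] := Tslim _ _ _ _ _ _ ab bc ca.
have [v vBD uv] := AN _ Au.
exists (h v); last by rewrite hd.
by case: vBD => ?; [left|right]; exists v.
Qed.

End Isometry.

(** Coordinates in [{i01 R}] carry no metric structure, so that segments are not
covered by the isometric images above. *)
Section Interval.
Context (h : {i01 R} -> Z).
Hypothesis hd : forall s t, mdist (h s) (h t) = `|s%:num - t%:num|.

Lemma interval_geodesic_subset : geodesic_subset (range h).
Proof.
have /choice[c cE] : forall u : R, exists t : {i01 R}, 0 <= u <= 1 -> t%:num = u.
  move=> u; have [/andP[u0 u1]|] := boolP (0 <= u <= 1); last by exists 0%:i01.
  by exists (Itv01 u0 u1).
have le s t : s%:num <= t%:num ->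
    exists2 A, A `<=` range h & geodesic_between (h s) (h t) A.
  move=> st; have s0 : 0 <= s%:num by []. have t1 : t%:num <= 1 by [].
  exists ((h \o c) @` `[s%:num, t%:num]); first by move=> _ [u _ <-]; exists (c u).
  have c_num r : c r%:num = r by apply/val_inj/cE/andP; split.
  exists s%:num, t%:num, (h \o c); split; rewrite /= ?c_num// => u v.
  rewrite !in_itv/= => /andP[u1 u2] /andP[v1 v2].
  by rewrite hd !cE//; apply/andP; split; lra.
move=> _ _ [s _ <-] [t _ <-]; have [/le//|/ltW/le[A AC ts]] := leP s%:num t%:num.
by exists A => //; exact: geodesic_between_sym.
Qed.

Lemma interval_slim_subset : slim_subset (range h) 0.
Proof.
have between (x y u : {i01 R}) B : geodesic_between (h x) (h y) B -> B `<=` range h ->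
    x%:num <= u%:num <= y%:num \/ y%:num <= u%:num <= x%:num -> B (h u).
  move=> xy BC uxy; have [|_ /[dup] /BC[v _ <-] Bv] :=
      @geodesic_between_at _ _ _ _ _ (`|x%:num - u%:num|) xy.
    rewrite normr_ge0 hd /=.
    by case: uxy => /andP[? ?]; [rewrite !ler0_norm|rewrite !ger0_norm]; lra.
  rewrite !hd => -[xv vy]; suff -> : u = v by [].
  apply/val_inj => /=.
  move: xv vy; case: (ler0P (_ - _)) => ?; case: (ler0P (_ - _)) => ?;
  case: (ler0P (_ - _)) => ?; case: (ler0P (_ - _)) => ?; case: uxy => /andP[? ?]; lra.
move=> x y z A B D xy yz zx AC BC DC _ /[dup] /AC[u _ <-] Au.
have := geodesic_betweenD xy Au.
have [[xC yC] [_ zC]] := (geodesic_between_ends xy, geodesic_between_ends yz).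
case: (AC _ xC) (AC _ yC) (BC _ zC) => [a _ ax] [b _ bY] [c _ cz].
rewrite -ax -bY -cz !hd in xy yz zx * => aub.
exists (h u); last by rewrite mdistxx.
have aub' : a%:num <= u%:num <= b%:num \/ b%:num <= u%:num <= a%:num.
  move: aub; case: (ler0P (_ - _)) => ?; case: (ler0P (_ - _)) => ?;
  case: (ler0P (_ - _)) => ?; do ?[by left; apply/andP; split; lra];
  by right; apply/andP; split; lra.
have [cu|/ltW uc] := leP c%:num u%:num; case: aub' => /andP[? ?].
- by left; apply: between yz BC _; right; apply/andP.
- by right; apply: between zx DC _; left; apply/andP.
- by right; apply: between zx DC _; right; apply/andP.
- by left; apply: between yz BC _; left; apply/andP.
Qed.

End Interval.
End Pieces.

(** * Spaces covered by a tree of pieces *)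

Section TreeOfPieces.
Context {R : realType} {Z : metricType R} {I : Type}.
Variables (C : I -> set Z) (r : I -> Z -> Z).
Implicit Types (p q x y z u : Z) (i j : I).

Inductive piece_chain : Z -> Z -> R -> Prop :=
| piece_chain_nil p : piece_chain p p 0
| piece_chain_cons i p q z l : C i p -> C i q -> piece_chain q z l ->
    piece_chain p z (mdist p q + l).

(** The dichotomy says that [r i] is constant on any piece other than [C i]; it is
stated for two points at a time so that overlapping pieces cause no trouble.
The last two fields say that the metric is a path metric; chain lengths never
fall below the distance, see [mdist_piece_chain]. *)
Record tree_of_pieces : Prop := {
  retract_in : forall i p, C i (r i p);
  retract_id : forall i p, C i p -> r i p = p;
  retract_dichotomy : forall i j p q, C j p -> C j q ->
    r i p = r i q \/ C i p /\ C i q;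
  piece_chain_ex : forall p q, exists l, piece_chain p q l;
  piece_chain_inf : forall p q c,
    (forall l, piece_chain p q l -> c <= l) -> c <= mdist p q }.

Hypothesis tree : tree_of_pieces.

Lemma mdist_piece_chain p q l : piece_chain p q l -> mdist p q <= l.
Proof.
elim=> [{}p|i {}p {}q z {}l _ _ _ IH]; first by rewrite mdistxx.
by apply: le_trans (metric_triangle _ q _) _; rewrite lerD2l.
Qed.

(** Along a chain from [p] to [q], a step either keeps the retraction fixed or
takes place inside [C i].  In the first case the triangle inequality absorbs
the step into the distance from [p] to [r i p]; in the second the chain has
already reached [r i p]. *)
Lemma retract_mdist i p q : r i p <> r i q ->
  mdist p q = mdist p (r i p) + mdist (r i p) (r i q) + mdist (r i q) q.
Proof.
move=> pq; apply/eqP; rewrite eq_le; apply/andP; split.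
  by rewrite -addrA; apply: le_trans (metric_triangle _ (r i p) _) _;
    rewrite lerD2l metric_triangle.
apply: piece_chain_inf => // l c.
elim: c pq => [//|j {}p z {}q {}l jp jz zq IH] pq.
have := mdist_piece_chain zq; have := metric_triangle p z (r i p).
case: (retract_dichotomy tree i jp jz) => [E|[ip iz]].
  by move: IH; rewrite -E => /(_ pq); lra.
rewrite (retract_id tree ip) (retract_id tree iz) in pq IH *.
have [<-|/eqP zr] := eqVneq z (r i q); first by rewrite mdistxx; lra.
have := metric_triangle p z (r i q); have := IH zr; rewrite !mdistxx; lra.
Qed.

Lemma retract_mdist_in i p q : C i q -> mdist p q = mdist p (r i p) + mdist (r i p) q.
Proof.
move=> iq; have qE := retract_id tree iq.
have [<-|/eqP pq] := eqVneq (r i p) q; first by rewrite mdistxx addr0.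
by rewrite (@retract_mdist i) qE// mdistxx addr0.
Qed.

(** At a point [u] where many pieces meet, most of them retract [x] to [u] itself.
The piece pointing towards [x] is found on a chain from [u] to [x]: it is the
piece of the last step that leaves [u], and the dichotomy shows that the rest
of the chain cannot bring its retraction back to [u]. *)
Lemma retract_separates u x : u <> x -> exists2 i, C i u & r i x <> u.
Proof.
have [l c] := piece_chain_ex tree x u.
elim: c => [//|i {}x z {}u {}l ix iz _ IH] ux.
(* The chain runs from [x] to [u], so that induction removes the end at [x]. *)
have [zu|/eqP /nesym zu] := eqVneq z u.
  by exists i; rewrite -?zu// (retract_id tree ix) zu; exact: nesym.
have [j ju jz] := IH zu; exists j => // xu.
case: (retract_dichotomy tree j ix iz) => [E|[jx _]]; first by rewrite -E in jz.
by rewrite (retract_id tree jx) in xu; apply: ux.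
Qed.

(** The point [u] of the geodesic at distance [mdist p (r i p)] from [p] has the same
retraction as [p], as otherwise reaching [u] would take longer than that; then
the formula for the distance from [u] to [q] leaves no room between [u] and
[r i p]. *)
Lemma geodesic_through_retract i p q A : geodesic_between p q A ->
  r i p <> r i q -> A (r i p) /\ A (r i q).
Proof.
have through x y B : geodesic_between x y B -> r i x <> r i y -> B (r i x).
  move=> xy rxy; have dxy := retract_mdist rxy.
  have rxy0 : 0 < mdist (r i x) (r i y) by rewrite mdist_gt0; apply/eqP.
  have [|u Bu [xu uy]] := @geodesic_between_at _ _ _ _ _ (mdist x (r i x)) xy.
    by rewrite mdist_ge0 dxy -addrA lerDl addr_ge0 ?mdist_ge0.
  have ru : r i u = r i x.
    apply/eqP/negPn/negP => /eqP/nesym ne; have := retract_mdist ne.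
    have : 0 < mdist (r i x) (r i u) by rewrite mdist_gt0; apply/eqP.
    by have := mdist_ge0 (r i u) u; lra.
  suff <- : u = r i x by [].
  apply: mdist_positivity; rewrite -ru in rxy.
  by have := retract_mdist rxy; rewrite ru; lra.
move=> pq rpq; split; first exact: through pq rpq.
by apply: through (geodesic_between_sym pq) (nesym rpq).
Qed.

(** Retracting a point on a geodesic with ends in the piece does not lengthen the
path through it, and shortens it strictly unless the point is fixed. *)
Lemma piece_convex i x y A :
  C i x -> C i y -> geodesic_between x y A -> A `<=` C i.
Proof.
move=> ix iy xy w Aw; suff <- : r i w = w by exact: retract_in.
apply/esym/mdist_positivity/eqP; rewrite eq_le mdist_ge0 andbT.
have := geodesic_betweenD xy Aw; have := metric_triangle x (r i w) y.
have := retract_mdist_in w ix; have := retract_mdist_in w iy.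
by rewrite (metric_sym x w) (metric_sym x (r i w)); lra.
Qed.

Lemma geodesic_between_retract i p q A : geodesic_between p q A ->
  r i p <> r i q ->
  exists B, [/\ geodesic_between (r i p) (r i q) B, B `<=` C i, B `<=` A
    & A `&` C i `<=` B].
Proof.
move=> pq rpq; have [Ap Aq] := geodesic_through_retract pq rpq.
have pr := retract_mdist_in p (retract_in tree i q).
have dpq := retract_mdist rpq.
have := sub_geodesic pq Ap Aq; rewrite pr lerDl => /(_ (mdist_ge0 _ _)) sub.
eexists; split; first exact: sub.
- exact: piece_convex (retract_in tree i p) (retract_in tree i q) sub.
- by move=> w [].
move=> u [Au iu]; split=> //.
have := geodesic_betweenD pq Au; have := retract_mdist_in p iu.
have := retract_mdist_in q iu; rewrite (metric_sym q u) (metric_sym q (r i q)).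
have := mdist_ge0 (r i q) u; have := mdist_ge0 (r i p) u.
by move=> *; apply/andP; split; lra.
Qed.

(** Induction on a chain.  For a first step from [p] to [q] inside [C i], go from [p]
to the retraction of the target inside [C i], and then follow the geodesic from
[q], which passes through this retraction. *)
Lemma tree_geodesic_space : (forall i, geodesic_subset (C i)) -> geodesic_space Z.
Proof.
move=> Cg x y; have [l c] := piece_chain_ex tree x y.
elim: c => [p|i p q z {}l ip iq _ [A qz]].
  by exists [set p]; exact: geodesic_between_xx.
have [B _ pB] := Cg i p (r i z) ip (retract_in tree i z).
have [D rD] : exists D, geodesic_between (r i z) z D.
  have [qr|/eqP qr] := eqVneq q (r i z); first by exists A; rewrite -qr.
  have rq := retract_id tree iq; rewrite -rq in qr.
  have [_ Ar] := geodesic_through_retract qz qr.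
  have [_ Az] := geodesic_between_ends qz.
  eexists; apply: (sub_geodesic qz Ar Az).
  by rewrite -(geodesic_betweenD qz Ar) lerDl mdist_ge0.
apply: geodesic_between_cat pB rD _.
by rewrite metric_sym (retract_mdist_in z ip) addrC [in RHS]metric_sym (metric_sym z).
Qed.

(** Projecting the triangle to a piece [C i] around [u] that sees [x] gives a
triangle in [C i].  At most one of its two other sides can be degenerate, since
the ends of the first side are distinct; the degenerate side is then a vertex of
the remaining one. *)
Lemma tree_rips (delta : R) : 0 <= delta ->
  (forall i, slim_subset (C i) delta) -> rips_condition Z delta.
Proof.
move=> delta0 Cslim; apply: slim_subset_rips => x y z A B D xy yz zx _ _ _ u Au.
have [->|/eqP ux] := eqVneq u x.
  exists x; last by rewrite mdistxx.
  by right; case: (geodesic_between_ends zx).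
have [i iu ru] := retract_separates ux.
have rxy : r i x <> r i y.
  move=> E; apply: ru; apply: mdist_positivity.
  have := geodesic_betweenD xy Au; have := retract_mdist_in x iu.
  have := retract_mdist_in y iu; rewrite E (metric_sym y u).
  have := metric_triangle x (r i y) y; have := mdist_ge0 (r i y) u.
  by rewrite (metric_sym (r i y) y); lra.
have [A' [xy' A'C _ AA']] := geodesic_between_retract xy rxy.
(* A degenerate side is replaced by a single point, which need not belong to the
   side that it comes from. *)
have side p q E : geodesic_between p q E -> exists E',
    [/\ geodesic_between (r i p) (r i q) E', E' `<=` C i &
     r i p <> r i q -> E' `<=` E] /\ (r i p = r i q -> E' = [set r i p]).
  move=> pq; have [rpq|/eqP rpq] := eqVneq (r i p) (r i q).
    exists [set r i p]; split=> //; split=> //.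
    - by rewrite -rpq; exact: geodesic_between_xx.
    - by move=> _ ->; exact: retract_in.
  by have [E' [? ? ? _]] := geodesic_between_retract pq rpq; exists E'.
have [B' [[yz' B'C B'B] B1]] := side _ _ _ yz.
have [D' [[zx' D'C D'D] D1]] := side _ _ _ zx.
have [v BDv uv] := Cslim i _ _ _ _ _ _ xy' yz' zx' A'C B'C D'C u (AA' u (conj Au iu)).
exists v => //.
have [[_ Bz] [Dz _]] := (geodesic_between_ends yz', geodesic_between_ends zx').
case: BDv => [Bv|Dv].
  have [ryz|/eqP ryz] := eqVneq (r i y) (r i z); last by left; apply: B'B.
  right; move: Bv; rewrite B1// => ->; rewrite ryz; apply: D'D => //.
  by rewrite -ryz; exact: nesym.
have [rzx|/eqP rzx] := eqVneq (r i z) (r i x); last by right; apply: D'D.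
by left; move: Dv; rewrite D1// => ->; apply: B'B => //; rewrite rzx; exact: nesym.
Qed.

End TreeOfPieces.

(** * Prefixes of words *)

Section Words.
Context {L T : Type}.
Implicit Types (v w : seq L) (l : L).

(** The letter at which the word [v] leaves its prefix [w], mapped by [f]; the value
is [e] if [v] does not properly extend [w].  With [f] giving net points and [e] the
base point, this is the point of the sheet at [w] through which the sheet at [v]
is reached. *)
Definition gate (f : L -> T) (e : T) w v : T :=
  if `[< take (size w) v = w >] then nth e (map f v) (size w) else e.

(** Crossing an edge that does not start at [w] leaves the gate unchanged.  If [v]
is one letter short of [w], both sides are the default [e]. *)
Lemma gate_rcons f e w v l : w <> v -> gate f e w (rcons v l) = gate f e w v.
Proof.
move=> wv; rewrite /gate map_rcons nth_rcons size_map.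
have [wv'|vw|E] := ltngtP (size w) (size v).
- by rewrite -cats1 takel_cat// ltnW.
- by rewrite if_same nth_default ?size_map ?if_same// ltnW.
rewrite E take_size -cats1 takel_cat// take_size asboolF; last exact: nesym.
by [].
Qed.

Lemma gate_rcons_id f e w l : gate f e w (rcons w l) = f l.
Proof.
by rewrite /gate -cats1 take_size_cat// asboolT// map_cat nth_cat size_map ltnn subnn.
Qed.

Lemma gate_id f e w : gate f e w w = e.
Proof. by rewrite /gate nth_default ?size_map ?if_same. Qed.

Lemma gate_nil f e w : gate f e w [::] = e.
Proof. by rewrite /gate nth_nil if_same. Qed.

Definition extends v w := `[< take (size v) w = v >].

Lemma extends_rcons v w l : rcons w l <> v ->
  extends v (rcons w l) = extends v w.
Proof.
move=> wv; apply/asboolP/asboolP; rewrite -cats1.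
  have [vw|wv'] := leqP (size v) (size w); first by rewrite takel_cat.
  by rewrite take_oversize ?cats1// size_rcons.
by move=> E; rewrite takel_cat// -E size_take_min geq_minr.
Qed.

Lemma extends_id v : extends v v.
Proof. by apply/asboolP; rewrite take_size. Qed.

Lemma extends_lt v w : (size w < size v)%N -> extends v w = false.
Proof.
move=> wv; apply/asboolPn; rewrite take_oversize 1?ltnW// => E.
by rewrite E ltnn in wv.
Qed.

End Words.

(** * The retractions of a free product onto its pieces *)

Section FreeProduct.
Context {R : realType} {X Y : metricType R} (NX : net X) (NY : net Y).
Variables (epsX : NX) (epsY : NY).

Local Notation WX := (wordsX epsX epsY).
Local Notation WY := (wordsY epsX epsY).
Local Notation letter := (letter epsX epsY).
Local Notation pre := (pre_free_product epsX epsY).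
Local Notation FP := (free_product epsX epsY).
Local Notation pi := (\pi_FP).
Local Notation glue := (@Defs.glue _ _ _ NX NY epsX epsY).

(** A sheet at [w] is left either through a net point, along an edge labelled by a
letter of its own kind, or through the base point.  Letters of the other kind
occur after [w] only for the empty word, where they lead across the edge
between the two root sheets, attached at the base points. *)
Definition netX (l : letter) : X :=
  if l is inl x0 then net_map NX (sval x0) else net_base NX.
Definition netY (l : letter) : Y :=
  if l is inr y0 then net_map NY (sval y0) else net_base NY.

(** An edge is given the word of the sheet at its far end, so that one word
describes all points behind the start of the edge. *)
Definition word (p : pre) : seq letter :=
  match p with
  | SheetX w _ => sval w
  | SheetY w _ => sval w
  | EdgeX w x0 _ => rcons (sval w) (inl x0)
  | EdgeY w y0 _ => rcons (sval w) (inr y0)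
  | Edge0 _ => [::]
  end.

Definition end01 (b : bool) : {i01 R} := if b then 1%:i01 else 0%:i01.

(** Coordinates of the retraction of [p] onto the sheet at [w]. *)
Definition coordX (w : WX) (p : pre) : X :=
  let far := gate netX (net_base NX) (sval w) (word p) in
  if p is SheetX w' x then if `[< w' = w >] then x else far else far.

Definition coordY (w : WY) (p : pre) : Y :=
  let far := gate netY (net_base NY) (sval w) (word p) in
  if p is SheetY w' y then if `[< w' = w >] then y else far else far.

(** Coordinates of the retraction onto the edge that leads to the sheet at [v].  This
serves both kinds of edges, because the last letter of [v] tells them apart. *)
Definition coordE (v : seq letter) (p : pre) : {i01 R} :=
  let far := end01 (extends v (word p)) in
  match p with
  | EdgeX _ _ t | EdgeY _ _ t => if `[< word p = v >] then t else far
  | _ => far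
  end.

(** Coordinates of the retraction onto the edge between the root sheets: the side on
which [p] lies is told by the first letter of its word or, for the empty word, by
the sheet.  The default in the case of other edges is never reached, as their
words are not empty. *)
Definition coord0 (p : pre) : {i01 R} :=
  let far b := end01 (head b (map (@is_Y _ _ epsX epsY) (word p))) in
  match p with
  | SheetX _ _ => far false
  | SheetY _ _ => far true
  | Edge0 t => t
  | _ => far false
  end.

Inductive piece :=
| PieceX of WX
| PieceY of WY
| PieceEX of WX & lettersX epsX
| PieceEY of WY & lettersY epsY
| PieceE0.

Definition retract (i : piece) (p : pre) : pre :=
  match i with
  | PieceX w => SheetX w (coordX w p)
  | PieceY w => SheetY w (coordY w p)
  | PieceEX w x0 => EdgeX w x0 (coordE (rcons (sval w) (inl x0)) p)
  | PieceEY w y0 => EdgeY w y0 (coordE (rcons (sval w) (inr y0)) p)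
  | PieceE0 => Edge0 epsX epsY (coord0 p)
  end.

Definition in_piece (i : piece) (p : pre) : Prop :=
  match i, p with
  | PieceX w, SheetX w' _ => w' = w
  | PieceY w, SheetY w' _ => w' = w
  | PieceEX w x0, EdgeX w' x0' _ => w' = w /\ x0' = x0
  | PieceEY w y0, EdgeY w' y0' _ => w' = w /\ y0' = y0
  | PieceE0, Edge0 _ => True
  | _, _ => False
  end.

Lemma sval_word_inj (P : pred (seq letter)) (w w' : {w | P w}) :
  sval w = sval w' -> w = w'.
Proof. exact: val_inj. Qed.

Lemma sval_neq (P : pred (seq letter)) (w w' : {w | P w}) : w <> w' -> sval w <> sval w'.
Proof. by move=> ww /sval_word_inj. Qed.

Lemma coordX_glue w p q : glue p q -> coordX w p = coordX w q.
Proof.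
case=> [||w' x0|w' x0|w' y0|w' y0]; rewrite /coordX /=.
- by rewrite !gate_nil if_same.
- by [].
- case: asboolP => [->|/sval_neq/nesym ne]; first by rewrite gate_rcons_id.
  by rewrite gate_rcons.
- by [].
- have [E|ne] := pselect (sval w = sval w').
    by rewrite -E gate_rcons_id gate_id.
  by rewrite gate_rcons.
- by case: asboolP => // <-; rewrite gate_id.
Qed.

Lemma coordY_glue w p q : glue p q -> coordY w p = coordY w q.
Proof.
case=> [||w' x0|w' x0|w' y0|w' y0]; rewrite /coordY /=.
- by [].
- by rewrite !gate_nil if_same.
- have [E|ne] := pselect (sval w = sval w').
    by rewrite -E gate_rcons_id gate_id.
  by rewrite gate_rcons.
- by case: asboolP => // <-; rewrite gate_id.
- case: asboolP => [->|/sval_neq/nesym ne]; first by rewrite gate_rcons_id.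
  by rewrite gate_rcons.
- by [].
Qed.

Lemma coordE_glue v p q : v <> [::] -> glue p q -> coordE v p = coordE v q.
Proof.
move=> v0; have v0' : extends v [::] = false.
  by apply: extends_lt; case: v v0.
case=> [||w' x0|w' x0|w' y0|w' y0]; rewrite /coordE /= ?v0' //.
- case: asboolP => [<-|ne]; first by rewrite extends_lt// size_rcons.
  by rewrite extends_rcons.
- by case: asboolP => [<-|//]; rewrite extends_id.
- case: asboolP => [<-|ne]; first by rewrite extends_lt// size_rcons.
  by rewrite extends_rcons.
- by case: asboolP => [<-|//]; rewrite extends_id.
Qed.

Lemma coord0_glue p q : glue p q -> coord0 p = coord0 q.
Proof.
by case=> [||[[|a w'] ?] x0|[[|a w'] ?] x0|[[|a w'] ?] y0|[[|a w'] ?] y0].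
Qed.

(** Gluing identifies the two descriptions of a point at the end of an edge; both
have the same coordinates, so the retraction descends to the free product. *)
Lemma retract_glue i p q : glue p q -> retract i p = retract i q.
Proof.
move=> pq; case: i => [w|w|w x0|w y0|] /=.
- by rewrite (coordX_glue _ pq).
- by rewrite (coordY_glue _ pq).
- by rewrite (coordE_glue _ pq)//; case: (sval w).
- by rewrite (coordE_glue _ pq)//; case: (sval w).
- by rewrite (coord0_glue pq).
Qed.

Lemma in_piece_retract i p : in_piece i (retract i p).
Proof. by case: i. Qed.

Lemma retract_in_piece i p : in_piece i p -> retract i p = p.
Proof.
by case: i => [w|w|w x0|w y0|]; case: p => [w' x|w' y|w' x0' t|w' y0' t|t] //=;
  do ?[move=> ->|case=> -> ->]; rewrite /coordX /coordY /coordE /= ?asboolT.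
Qed.

(** On a piece other than its own, a coordinate depends only on the word of the point,
which is the same all along the piece; for the root edge, on its kind as well. *)
Lemma retract_piece_dichotomy i j p q : in_piece j p -> in_piece j q ->
  retract i p = retract i q \/ in_piece i p /\ in_piece i q.
Proof.
have rconsI := @rcons_inj {classic letter}.
case: j => [w|w|w x0|w y0|]; case: p => [w1 x1|w1 y1|w1 x01 t1|w1 y01 t1|t1] //=;
  case: q => [w2 x2|w2 y2|w2 x02 t2|w2 y02 t2|t2] //=;
  do ?[move=> ->|case=> -> ->];
  case: i => [v|v|v a|v a|] /=; rewrite /coordX /coordY /coordE /=;
  do ?[by left|by right|by case: asboolP => ?; [right|left]].
all: case: asboolP => [/rconsI[e1 e2]|]; do ?[by left].
all: by right; rewrite e2 (sval_word_inj e1).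
Qed.

(** * The free product as a tree of pieces *)

Lemma ler_dist_free_product f p q : piecewise_short f ->
  `|f p - f q| <= mdist (pi p) (pi q).
Proof.
move=> fs; apply: free_product_dist_ge => l /(piecewise_short_chain fs).
by rewrite !(piecewise_short_pi fs (reprK _)).
Qed.

Lemma ler_dist_mdist (T : metricType R) (a x y : T) :
  `|mdist a x - mdist a y| <= mdist x y.
Proof.
have := metric_triangle a x y; have := metric_triangle a y x.
by rewrite (metric_sym y x) ler_norml => *; apply/andP; split; lra.
Qed.

(** Coordinates vary only along their own piece, with unit speed.  Hence they yield
short functions, which bound the distance in the free product from below by the
distance in the piece. *)
Lemma mdist_coordX_short w x : piecewise_short (fun p => mdist x (coordX w p)).
Proof.
split=> [p q /(coordX_glue w) -> //||||]; last 3 first.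
- by move=> *; rewrite subrr normr0.
- by move=> *; rewrite subrr normr0.
- by move=> *; rewrite subrr normr0.
split=> [w' x1 x2|*]; last by rewrite subrr normr0 mdist_ge0.
rewrite /coordX /=; case: asboolP => _; first exact: ler_dist_mdist.
by rewrite subrr normr0 mdist_ge0.
Qed.

Lemma mdist_coordY_short w y : piecewise_short (fun p => mdist y (coordY w p)).
Proof.
split=> [p q /(coordY_glue w) -> //||||]; last 3 first.
- by move=> *; rewrite subrr normr0.
- by move=> *; rewrite subrr normr0.
- by move=> *; rewrite subrr normr0.
split=> [*|w' y1 y2]; first by rewrite subrr normr0 mdist_ge0.
rewrite /coordY /=; case: asboolP => _; first exact: ler_dist_mdist.
by rewrite subrr normr0 mdist_ge0.
Qed.

Lemma coordE_short v : v <> [::] -> piecewise_short (fun p => (coordE v p)%:num).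
Proof.
move=> v0; split=> [p q /(coordE_glue v0) -> //||||].
- by split=> *; rewrite subrr normr0 mdist_ge0.
- by move=> w x0 s t; rewrite /coordE /=; case: asboolP; rewrite ?subrr ?normr0.
- by move=> w y0 s t; rewrite /coordE /=; case: asboolP; rewrite ?subrr ?normr0.
- by move=> *; rewrite subrr normr0.
Qed.

Lemma coord0_short : piecewise_short (fun p => (coord0 p)%:num).
Proof.
split=> [p q /coord0_glue -> //||||//].
- by split=> *; rewrite subrr normr0 mdist_ge0.
- by move=> *; rewrite subrr normr0.
- by move=> *; rewrite subrr normr0.
Qed.

Lemma mdist_sheetX w x x' : mdist (pi (SheetX w x)) (pi (SheetX w x')) = mdist x x'.
Proof.
apply/eqP; rewrite eq_le free_product_dist_le /=; last exact/chain1/dist_sheetX.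
apply: le_trans (ler_dist_free_product _ _ (mdist_coordX_short w x)).
by rewrite /coordX /= !asboolT// mdistxx sub0r normrN ger0_norm ?mdist_ge0.
Qed.

Lemma mdist_sheetY w y y' : mdist (pi (SheetY w y)) (pi (SheetY w y')) = mdist y y'.
Proof.
apply/eqP; rewrite eq_le free_product_dist_le /=; last exact/chain1/dist_sheetY.
apply: le_trans (ler_dist_free_product _ _ (mdist_coordY_short w y)).
by rewrite /coordY /= !asboolT// mdistxx sub0r normrN ger0_norm ?mdist_ge0.
Qed.

Lemma mdist_edgeX w x0 s t :
  mdist (pi (EdgeX w x0 s)) (pi (EdgeX w x0 t)) = `|s%:num - t%:num|.
Proof.
apply/eqP; rewrite eq_le free_product_dist_le /=; last exact/chain1/dist_edgeX.
have v0 : rcons (sval w) (inl x0) <> [::] by case: (sval w).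
apply: le_trans (ler_dist_free_product _ _ (coordE_short v0)).
by rewrite /coordE /= !asboolT.
Qed.

Lemma mdist_edgeY w y0 s t :
  mdist (pi (EdgeY w y0 s)) (pi (EdgeY w y0 t)) = `|s%:num - t%:num|.
Proof.
apply/eqP; rewrite eq_le free_product_dist_le /=; last exact/chain1/dist_edgeY.
have v0 : rcons (sval w) (inr y0) <> [::] by case: (sval w).
apply: le_trans (ler_dist_free_product _ _ (coordE_short v0)).
by rewrite /coordE /= !asboolT.
Qed.

Lemma mdist_edge0 s t :
  mdist (pi (Edge0 _ _ s)) (pi (Edge0 _ _ t)) = `|s%:num - t%:num|.
Proof.
apply/eqP; rewrite eq_le free_product_dist_le /=; last exact/chain1/dist_edge0.
exact: le_trans (ler_dist_free_product _ _ coord0_short).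
Qed.

Definition piece_set (i : piece) : set FP := pi @` in_piece i.

Definition retract_fp (i : piece) (z : FP) : FP := pi (retract i (repr z)).

Lemma retract_fp_pi i p : retract_fp i (pi p) = pi (retract i p).
Proof.
congr pi; have /eqmodP/asboolP : pi (repr (pi p)) = pi p by exact: reprK.
move: (repr _) => q.
by elim=> [a b /(retract_glue i)|//|//|a b c _ -> _ ->].
Qed.

Lemma piece_dist_mdist z z' l : piece_dist z z' l ->
  exists i, [/\ piece_set i z, piece_set i z' & l = mdist z z'].
Proof.
case=> [w x x'|w y y'|w x0 s t|w y0 s t|s t];
  [exists (PieceX w)|exists (PieceY w)|exists (PieceEX w x0)
  |exists (PieceEY w y0)|exists PieceE0].
- by rewrite mdist_sheetX; split=> //; apply: imageP.
- by rewrite mdist_sheetY; split=> //; apply: imageP.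
- by rewrite mdist_edgeX; split=> //; apply: imageP.
- by rewrite mdist_edgeY; split=> //; apply: imageP.
- by rewrite mdist_edge0; split=> //; apply: imageP.
Qed.

Lemma chain_piece_chain z z' l : chain z z' l -> piece_chain piece_set z z' l.
Proof.
elim=> [{}z|{}z {}z' z'' {}l m /piece_dist_mdist[i [iz iz' ->]] _ IH].
  exact: piece_chain_nil.
exact: piece_chain_cons iz iz' IH.
Qed.

Lemma free_product_tree : tree_of_pieces piece_set retract_fp.
Proof.
split.
- by move=> i z; exists (retract i (repr z)) => //; exact: in_piece_retract.
- by move=> i _ [p ip <-]; rewrite retract_fp_pi retract_in_piece.
- move=> i j _ _ [p jp <-] [q jq <-]; rewrite !retract_fp_pi.
  have [->|[ip iq]] := retract_piece_dichotomy i jp jq; first by left.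
  by right; split; [exists p|exists q].
- by move=> z z'; have [l /chain_piece_chain] := joinedT z z'; exists l.
- move=> z z' c h; apply: free_product_dist_ge => l /chain_piece_chain; exact: h.
Qed.

Lemma piece_set_range i :
  [\/ exists w, piece_set i = range (fun x => pi (SheetX w x)),
      exists w, piece_set i = range (fun y => pi (SheetY w y)) |
      exists2 h : {i01 R} -> FP, piece_set i = range h &
        forall s t, mdist (h s) (h t) = `|s%:num - t%:num| ].
Proof.
case: i => [w|w|w x0|w y0|].
- constructor 1; exists w; apply/seteqP.
  split=> [_ [[w' x|w' y|w' a t|w' a t|t] // ->] <-|_ [x _ <-]]; first by exists x.
  by exists (SheetX w x).
- constructor 2; exists w; apply/seteqP.
  split=> [_ [[w' x|w' y|w' a t|w' a t|t] // ->] <-|_ [y _ <-]]; first by exists y.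
  by exists (SheetY w y).
- constructor 3; exists (fun t => pi (EdgeX w x0 t)); last exact: mdist_edgeX.
  apply/seteqP.
  split=> [_ [[w' x|w' y|w' a t|w' a t|t] // [-> ->]] <-|_ [t _ <-]]; first by exists t.
  by exists (EdgeX w x0 t).
- constructor 3; exists (fun t => pi (EdgeY w y0 t)); last exact: mdist_edgeY.
  apply/seteqP.
  split=> [_ [[w' x|w' y|w' a t|w' a t|t] // [-> ->]] <-|_ [t _ <-]]; first by exists t.
  by exists (EdgeY w y0 t).
- constructor 3; exists (fun t => pi (Edge0 epsX epsY t)); last exact: mdist_edge0.
  apply/seteqP.
  split=> [_ [[w' x|w' y|w' a t|w' a t|t] // _] <-|_ [t _ <-]]; first by exists t.
  by exists (Edge0 epsX epsY t).
Qed.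

End FreeProduct.

Theorem theorem5p3 (R : realType) (X Y : metricType R) (NX : net X) (NY : net Y)
    (epsX : NX) (epsY : NY)
    (hepsX : net_map NX epsX = net_base NX)
    (hepsY : net_map NY epsY = net_base NY) :
  geodesic_gromov_hyperbolic X -> geodesic_gromov_hyperbolic Y ->
  geodesic_gromov_hyperbolic (free_product epsX epsY).
Proof.
move=> [Xgeo [dX dX0 Xslim]] [Ygeo [dY dY0 Yslim]].
have tree := free_product_tree epsX epsY; split.
  apply: tree_geodesic_space tree _ => i.
  have [[w ->]|[w ->]|[h -> hd]] := piece_set_range i.
  - exact: isometry_geodesic_subset (mdist_sheetX w) Xgeo.
  - exact: isometry_geodesic_subset (mdist_sheetY w) Ygeo.
  - exact: interval_geodesic_subset hd.
have dXY : 0 <= Num.max dX dY by rewrite le_max dX0.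
exists (Num.max dX dY) => //.
refine (tree_rips tree dXY _) => i.
have [[w ->]|[w ->]|[h -> hd]] := piece_set_range i.
- apply: slim_subset_le (isometry_slim_subset (mdist_sheetX w) Xslim).
  by rewrite le_max lexx.
- apply: slim_subset_le (isometry_slim_subset (mdist_sheetY w) Yslim).
  by rewrite le_max lexx orbT.
- exact: slim_subset_le dXY (interval_slim_subset hd).
Qed.
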